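(* Let $k\ge1$. No point of $V_{2k,k}=U(2k)/U_{2k}(k)$ of the form $\left[\begin{pmatrix}0&D\\C&0\end{pmatrix}\right]$ with $C,D\in U(k)$ belongs to the normal cut locus of $V_{2k,k}$ from the point $Id=[I_{2k}]$.
   Context: Let $n=2k$. Here $U_{2k}(k)$ denotes the subgroup $\left\{\begin{pmatrix} I_k&0\\0&W\end{pmatrix}: W\in U(k)\right\}\subset U(2k)$. The Stiefel manifold is $V_{2k,k}=U(2k)/U_{2k}(k)$ (identification $q\sim qh$, $h$ in this subgroup), with projection $\pi_1:q\mapsto[q]$; it is identified with $\{X\in\mathbb C^{2k\times k}:\bar X^TX=I_k\}$ by taking the first $k$ columns of $q$. Sub-Riemannian structure: the horizontal space at $[q]$ is $\mathcal H_{[q]}=\left\{d_q\pi_1\left(q\begin{pmatrix}0&B\\-\bar B^T&0\end{pmatrix}\right): B\in\mathbb C^{k\times k}\right\}$, with inner product $\left\langle d_q\pi_1(q\mathcal X),d_q\pi_1(q\mathcal Y)\right\rangle=-2n\,\mathrm{tr}(\mathcal X\mathcal Y)$ for $\mathcal X,\mathcal Y$ of the form $\begin{pmatrix}0&B\\-\bar B^T&0\end{pmatrix}$. A horizontal curve is an absolutely continuous curve $\gamma$ with $\dot\gamma(t)\in\mathcal H_{\gamma(t)}$ a.e.; its length is $\int\sqrt{\langle\dot\gamma,\dot\gamma\rangle}\,dt$; the distance $d$ is the infimum of lengths of horizontal curves joining two points; a horizontal curve is minimizing if its length equals the distance between its endpoints. The normal sub-Riemannian geodesics starting at $Id$ are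 the curves $$\gamma_v(t)=\left[\exp\left(t\begin{pmatrix}A&B\\-\bar B^T&0\end{pmatrix}\right)\exp\left(-t\begin{pmatrix}A&0\\0&0\end{pmatrix}\right)\right],\qquad v=\begin{pmatrix}A&B\\-\bar B^T&0\end{pmatrix},\ A\in\mathfrak u(k),\ B\in\mathbb C^{k\times k}.$$ The normal cut locus from $Id$ is the set of points $q$ for which there exist $T>0$ and two distinct normal geodesics $\gamma_{v_1}\ne\gamma_{v_2}$ starting at $Id$, both minimizing on $[0,T]$, with $\gamma_{v_1}(T)=\gamma_{v_2}(T)=q$. *)

(* Defs.v *)
From HB Require Import structures.
From mathcomp Require Import all_boot all_order all_algebra.
From mathcomp Require Import sesquilinear spectral.
From mathcomp Require Import complex.
From mathcomp Require Import all_classical all_reals all_analysis.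

Set Implicit Arguments.
Unset Strict Implicit.
Unset Printing Implicit Defensive.

Import Order.TTheory GRing.Theory Num.Theory.
Import numFieldNormedType.Exports.

Local Open Scope classical_set_scope.
Local Open Scope ring_scope.
Local Open Scope complex_scope.
Local Open Scope sesquilinear_scope.

(* The complex numbers are R[i] for R : realType; M ^t* is the conjugate
   transpose. *)

Definition expmx (K : numFieldType) n (A : 'M[K]_n) : 'M[K]_n :=
  lim (series (fun p : nat => (p`!%:R : K)^-1 *: A ^+ p) @ \oo).

Section Curves.
Variable R : realType.

Definition absolutely_continuous (a b : R) (f : R -> R) : Prop :=
  forall e : R, 0 < e -> exists2 d : R, 0 < d &
    forall (N : nat) (l r : 'I_N -> R),
      (forall i, a <= l i /\ l i <= r i /\ r i <= b) ->
      trivIset setT (fun i => [set` `]l i, r i[]) ->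
      \sum_(i < N) (r i - l i) < d ->
      \sum_(i < N) `|f (r i) - f (l i)| < e.

Variables m n : nat.
Implicit Types g : R -> 'M[R[i]]_(m, n).

(* A curve in the complex m x n matrices depends on a real parameter; its
   regularity is that of its 2mn real coordinates. *)
Definition re_coord g (i : 'I_m) (j : 'I_n) (t : R) : R := complex.Re (g t i j).
Definition im_coord g (i : 'I_m) (j : 'I_n) (t : R) : R := complex.Im (g t i j).

Definition abs_cont_curve (a b : R) g : Prop :=
  forall i j, absolutely_continuous a b (re_coord g i j) /\
              absolutely_continuous a b (im_coord g i j).

Definition derivable_curve g (t : R) : Prop :=
  forall i j, derivable (re_coord g i j) t 1 /\ derivable (im_coord g i j) t 1.

Definition velocity g (t : R) : 'M[R[i]]_(m, n) :=
  \matrix_(i, j) (derive1 (re_coord g i j) t +i* derive1 (im_coord g i j) t).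

End Curves.

Section Stiefel.
Variables (R : realType) (k : nat).
Notation C := R[i].

(* The quotient U(2k)/U_2k(k) is realized as the set of the 2k x k matrices
   with orthonormal columns, the class [q] being the first k columns of q:
   see stiefel_pi_in, stiefel_pi_surj and stiefel_pi_eqP. *)
Definition stiefel : set 'M[C]_(k + k, k) := [set X | X ^t* *m X = 1%:M].

Definition stiefel_pi (q : 'M[C]_(k + k)) : 'M[C]_(k + k, k) := lsubmx q.

Lemma unitarymxPl n (q : 'M[C]_n) : reflect (q^t* *m q = 1%:M) (q \is unitarymx).
Proof. by apply: (iffP idP) => [/unitarymxP|] h; [|apply/unitarymxP]; exact: mulmx1C. Qed.

Lemma adjmxK m n (X : 'M[C]_(m, n)) : X^t*^t* = X.
Proof. by apply/matrixP => i j; rewrite !mxE conjCK. Qed.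

Lemma stiefel_pi_in (q : 'M[C]_(k + k)) : q \is unitarymx -> stiefel (stiefel_pi q).
Proof.
move=> /unitarymxPl; rewrite /stiefel /stiefel_pi /= -{1 2}[q]hsubmxK.
rewrite tr_row_mx map_col_mx mul_col_row (@scalar_mx_block _ k k).
by move=> /eq_block_mx [].
Qed.

Lemma stiefel_pi_surj (X : 'M[C]_(k + k, k)) :
  stiefel X -> exists2 q, q \is unitarymx & stiefel_pi q = X.
Proof.
move=> X1.
have uX : X^t* \is unitarymx by apply/unitarymxP; rewrite adjmxK.
pose S := schmidt (row_base (orthomx Num.conj 1%:M (X^t*))).
have rY : \rank (orthomx Num.conj 1%:M (X^t*)) = k.
  by rewrite rank_ortho (mxrank_unitary uX) addnK.
have uS : S \is unitarymx by rewrite schmidt_unitarymx // rank_leq_col.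
have SX : S *m X = 0.
  have := @orthomx1P C _ _ _ S (X^t*); rewrite adjmxK => h; apply/h.
  by rewrite eqmx_schmidt_free ?row_base_free // eq_row_base.
move: S uS SX; rewrite rY => S uS SX.
exists (row_mx X (S^t*)); last by rewrite /stiefel_pi row_mxKl.
apply/unitarymxPl; rewrite tr_row_mx map_col_mx mul_col_row adjmxK SX X1.
move: uS => /unitarymxP ->; rewrite (@scalar_mx_block _ k k); congr block_mx.
by rewrite -[LHS]adjmxK trmx_mul map_mxM !adjmxK SX trmx0 map_mx0.
Qed.

Lemma stiefel_pi_eqP (q1 q2 : 'M[C]_(k + k)) :
  q1 \is unitarymx -> q2 \is unitarymx ->
  (stiefel_pi q1 = stiefel_pi q2 <->
   exists2 W : 'M[C]_k, W \is unitarymx & q2 = q1 *m block_mx 1%:M 0 0 W).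
Proof.
move=> u1 u2; rewrite /stiefel_pi; split=> [e|[W _ ->]]; last first.
  by rewrite -{2}[q1]hsubmxK mul_row_block row_mxKl mulmx1 mulmx0 addr0.
move: e (u1) (u2); rewrite -[q1]hsubmxK -[q2]hsubmxK !row_mxKl => e.
rewrite -e; set X := lsubmx q1; set Y := rsubmx q1; set Z := rsubmx q2.
move=> v1 /unitarymxPl; move: (v1) => /unitarymxPl /[swap].
rewrite !tr_row_mx !map_col_mx !mul_col_row (@scalar_mx_block _ k k).
move=> /eq_block_mx [_ XZ _ ZZ] /eq_block_mx [XX XY _ YY].
have /unitarymxP := v1; rewrite tr_row_mx map_col_mx mul_row_col => P.
have ZE : Z = Y *m (Y^t* *m Z).
  by rewrite -[LHS]mul1mx -P mulmxDl -mulmxA XZ mulmx0 add0r mulmxA.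
exists (Y^t* *m Z); last by rewrite mul_row_block !mulmx0 mulmx1 addr0 add0r -ZE.
by apply/unitarymxPl; rewrite trmx_mul map_mxM adjmxK -mulmxA -ZE.
Qed.

Definition hmx (B : 'M[C]_k) : 'M[C]_(k + k) := block_mx 0 B (- B ^t*) 0.

(* stiefel_pi is linear, hence equal to its own differential at every q. *)
Definition horizontal (p : 'M[C]_(k + k, k)) : set 'M[C]_(k + k, k) :=
  [set w | exists q B, [/\ q \is unitarymx, stiefel_pi q = p &
                           w = stiefel_pi (q *m hmx B)]].

(* The inner product on the horizontal space at p, with n = k + k; the value
   does not depend on the representatives (sr_innerE), and is 0 by convention
   when w1 or w2 is not horizontal at p. The trace below is a real number. *)
Definition sr_inner (p w1 w2 : 'M[C]_(k + k, k)) : R :=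
  xget 0 [set r | exists q B1 B2,
    [/\ q \is unitarymx, stiefel_pi q = p,
        w1 = stiefel_pi (q *m hmx B1), w2 = stiefel_pi (q *m hmx B2) &
        r = complex.Re (- (2 * (k + k)%:R) * \tr (hmx B1 *m hmx B2))]].

Lemma sr_innerE (q : 'M[C]_(k + k)) (B1 B2 : 'M[C]_k) : q \is unitarymx ->
  sr_inner (stiefel_pi q) (stiefel_pi (q *m hmx B1)) (stiefel_pi (q *m hmx B2)) =
  complex.Re (- (2 * (k + k)%:R) * \tr (hmx B1 *m hmx B2)).
Proof.
have trE (X Y : 'M[C]_k) : \tr (hmx X *m hmx Y) = - (\tr (Y^t* *m X) + \tr (X^t* *m Y)).
  rewrite /hmx mulmx_block !mul0mx !mulmx0 !addr0 !add0r mxtrace_block.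
  by rewrite mulmxN mulNmx !raddfN /= opprD [\tr (X *m _)]mxtrace_mulC.
have pE (p : 'M[C]_(k + k)) X : stiefel_pi (p *m hmx X) = - (rsubmx p *m X^t*).
  by rewrite /stiefel_pi -{1}[p]hsubmxK mul_row_block row_mxKl mulmx0 add0r mulmxN.
move=> uq; rewrite /sr_inner; apply: xget_unique.
  by exists q, B1, B2.
move=> _ [p [X1 [X2 [up pq e1 e2 ->]]]]; rewrite !trE; congr (complex.Re (_ * - _)).
have [W uW qE] := (stiefel_pi_eqP uq up).1 (esym pq).
have {}qE : rsubmx p = rsubmx q *m W.
  by rewrite qE -{1}[q]hsubmxK mul_row_block row_mxKr mulmx0 add0r.
have uY : (rsubmx q)^t* *m rsubmx q = 1%:M.
  move/unitarymxPl: uq; rewrite -{1 2}[q]hsubmxK tr_row_mx map_col_mx mul_col_row.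
  by rewrite (@scalar_mx_block _ k k) => /eq_block_mx [].
have BE (X B : 'M[C]_k) : stiefel_pi (q *m hmx B) = stiefel_pi (p *m hmx X) -> B^t* = W *m X^t*.
  rewrite !pE qE => /oppr_inj /(congr1 (fun M => (rsubmx q)^t* *m M)).
  by rewrite !mulmxA uY !mul1mx.
have {BE} BE2 (X B : 'M[C]_k) : stiefel_pi (q *m hmx B) = stiefel_pi (p *m hmx X) -> B = X *m W^t*.
  by move=> /BE h; rewrite -[B]adjmxK h trmx_mul map_mxM adjmxK.
rewrite (BE2 _ _ e1) (BE2 _ _ e2) !trmx_mul !map_mxM !adjmxK !mulmxA.
have t (M N : 'M[C]_k) : \tr (W *m M^t* *m N *m W^t*) = \tr (M^t* *m N).
  by rewrite mxtrace_mulC !mulmxA (elimT (unitarymxPl _) uW) mul1mx.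
by rewrite !t.
Qed.

Definition horizontal_curve (a b : R) (g : R -> 'M[C]_(k + k, k)) : Prop :=
  [/\ forall t, t \in `[a, b] -> stiefel (g t),
      abs_cont_curve a b g &
      {ae lebesgue_measure, forall t : R, t \in `[a, b] ->
        derivable_curve g t /\ horizontal (g t) (velocity g t)}].

Definition sr_length (a b : R) (g : R -> 'M[C]_(k + k, k)) : \bar R :=
  (\int[lebesgue_measure]_(t in `[a, b])
     (Num.sqrt (sr_inner (g t) (velocity g t) (velocity g t)))%:E)%E.

Definition sr_dist (p q : 'M[C]_(k + k, k)) : \bar R :=
  ereal_inf [set L | exists a b g,
    [/\ a < b, horizontal_curve a b g, g a = p, g b = q & L = sr_length a b g]].

Definition minimizing (a b : R) (g : R -> 'M[C]_(k + k, k)) : Prop :=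
  horizontal_curve a b g /\ sr_length a b g = sr_dist (g a) (g b).

Definition normal_geodesic (A B : 'M[C]_k) (t : R) : 'M[C]_(k + k, k) :=
  stiefel_pi (expmx (t%:C *: block_mx A B (- B ^t*) 0)
              *m expmx ((- t%:C) *: block_mx A 0 0 0)).

(* A ^t* = - A says that A is in the Lie algebra u(k). *)
Definition is_normal_geodesic (g : R -> 'M[C]_(k + k, k)) : Prop :=
  exists A B : 'M[C]_k, A ^t* = - A /\ g = normal_geodesic A B.

(* The cut locus from [I_2k], where every normal_geodesic starts. Two normal
   geodesics are distinct when they differ as curves, not merely in (A, B). *)
Definition normal_cut_locus : set 'M[C]_(k + k, k) :=
  [set q | exists (T : R) (g1 g2 : R -> 'M[C]_(k + k, k)),
    [/\ 0 < T, is_normal_geodesic g1 /\ is_normal_geodesic g2, g1 <> g2,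
        minimizing 0 T g1 /\ minimizing 0 T g2 & g1 T = q /\ g2 T = q]].

End Stiefel.

(* Main.v *)
Require Import Defs.
From mathcomp Require Import all_boot all_order all_algebra.
From mathcomp Require Import sesquilinear spectral.
From mathcomp Require Import complex.
From mathcomp Require Import all_classical all_reals all_analysis.
From mathcomp Require Import ring lra.

Import Order.TTheory GRing.Theory Num.Theory.
Import numFieldNormedType.Exports.
Local Open Scope classical_set_scope.
Local Open Scope ring_scope.
Local Open Scope complex_scope.

(** The proof compares lengths in a round sphere.  A 2k x k matrix with
    orthonormal columns has Frobenius norm sqrt k, so the Stiefel manifold lies
    in the sphere of radius sqrt k of the Euclidean space of 2k x k complex
    matrices, with real inner product Re tr (X^* Y).  Up to the factor
    sqrt (8k), the sub-Riemannian length of a horizontal curve is its length in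
    that sphere.

    The base point p = (I; 0) and the end point Q' = (0; Q), Q unitary, are
    orthogonal, so a curve of the sphere joining them has length at least
    (pi / 2) sqrt k, with equality only for the great circle arc
    cos (c t) p + sin (c t) Q', c = pi / (2 T).  This arc happens to be
    horizontal ([great_arc_velocityE]), so it bounds the distance from above.  A
    minimizing normal geodesic from p to Q' has constant speed
    ([is_mderive_flow_lift], [rdot_flow_control]), is therefore not
    longer than the arc, and must coincide with it on [0, T]
    ([great_circle_of_orthogonal_ends]).

    The parameters (A, B) can be read off at time 0: the velocity there is
    (0; - B^* ), and the acceleration is (- B B^*; B^* A), whereas the arc has
    acceleration - c^2 p.  Hence B = - c Q^* and B^* A = 0, so A = 0
    ([minimizing_normal_geodesic]).  Two minimizing normal geodesics that reach
    Q' at the same time thus have the same parameters and are equal.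

    Since the blocks of a normal geodesic are exponentials of skew-Hermitian
    matrices, the spectral theorem reduces convergence and differentiation of
    the exponential series to the scalar functions cos and sin. *)

Set Implicit Arguments.
Unset Strict Implicit.
Unset Printing Implicit Defensive.
Local Open Scope sesquilinear_scope.

(** * Derivatives of complex and matrix curves *)

Section ComplexCurves.
Variable R : realType.
Notation C := R[i].

Lemma Re_mul (x y : C) :
  complex.Re (x * y) = complex.Re x * complex.Re y - complex.Im x * complex.Im y.
Proof. by case: x => a b; case: y. Qed.

Lemma Im_mul (x y : C) :
  complex.Im (x * y) = complex.Re x * complex.Im y + complex.Im x * complex.Re y.
Proof. by case: x => a b; case: y. Qed.

Lemma Re_add (x y : C) : complex.Re (x + y) = complex.Re x + complex.Re y.
Proof. by case: x => a b; case: y. Qed.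

Lemma Im_add (x y : C) : complex.Im (x + y) = complex.Im x + complex.Im y.
Proof. by case: x => a b; case: y. Qed.

Lemma Re_opp (x : C) : complex.Re (- x) = - complex.Re x.
Proof. by case: x. Qed.

Lemma Re_conjC (x : C) : complex.Re (Num.conj x) = complex.Re x.
Proof. by case: x. Qed.

Lemma Im_conjC (x : C) : complex.Im (Num.conj x) = - complex.Im x.
Proof. by case: x. Qed.

Lemma Re_sum (I : finType) (f : I -> C) :
  complex.Re (\sum_i f i) = \sum_i complex.Re (f i).
Proof. by elim/big_rec2 : _ => [//|i x y _ <-]; exact: Re_add. Qed.

Definition is_cderive (z : R -> C) (t : R) (l : C) : Prop :=
  is_derive t 1 (fun s => complex.Re (z s)) (complex.Re l) /\
  is_derive t 1 (fun s => complex.Im (z s)) (complex.Im l).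

Lemma is_cderive_cst (c : C) t : is_cderive (fun=> c) t 0.
Proof. by split; exact: is_derive_cst. Qed.

Lemma is_cderiveD z w t l m : is_cderive z t l -> is_cderive w t m ->
  is_cderive (fun s => z s + w s) t (l + m).
Proof.
move=> [h1 h2] [h3 h4]; split; rewrite ?Re_add ?Im_add.
- rewrite (_ : (fun s => _) = (fun s => complex.Re (z s)) \+ (fun s => complex.Re (w s))).
    exact: is_deriveD.
  by apply/funext => s; rewrite Re_add.
- rewrite (_ : (fun s => _) = (fun s => complex.Im (z s)) \+ (fun s => complex.Im (w s))).
    exact: is_deriveD.
  by apply/funext => s; rewrite Im_add.
Qed.

Lemma is_cderiveM z w t l m : is_cderive z t l -> is_cderive w t m ->
  is_cderive (fun s => z s * w s) t (l * w t + z t * m).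
Proof.
move=> [h1 h2] [h3 h4]; split.
- rewrite (_ : (fun s => _) =
    (fun s => complex.Re (z s)) * (fun s => complex.Re (w s)) -
    (fun s => complex.Im (z s)) * (fun s => complex.Im (w s))).
    apply: is_derive_eq; rewrite Re_add !Re_mul /GRing.scale /=; ring.
  by apply/funext => s; rewrite Re_mul.
- rewrite (_ : (fun s => _) =
    (fun s => complex.Re (z s)) * (fun s => complex.Im (w s)) +
    (fun s => complex.Im (z s)) * (fun s => complex.Re (w s))).
    apply: is_derive_eq; rewrite Im_add !Im_mul /GRing.scale /=; ring.
  by apply/funext => s; rewrite Im_mul.
Qed.

Lemma is_cderive_sum (I : finType) (z : I -> R -> C) t (l : I -> C) :
  (forall i, is_cderive (z i) t (l i)) ->
  is_cderive (fun s => \sum_i z i s) t (\sum_i l i).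
Proof.
move=> h; elim: (index_enum I) => [|i r IH].
  under eq_fun do rewrite big_nil.
  by rewrite big_nil; exact: is_cderive_cst.
under eq_fun do rewrite big_cons.
by rewrite big_cons; exact: is_cderiveD.
Qed.

Definition is_mderive m n (g : R -> 'M[C]_(m, n)) (t : R) (L : 'M[C]_(m, n)) : Prop :=
  forall i j, is_cderive (fun s => g s i j) t (L i j).

Lemma is_mderive_eq m n (g : R -> 'M[C]_(m, n)) t L L' :
  is_mderive g t L -> L = L' -> is_mderive g t L'.
Proof. by move=> h <-. Qed.

Lemma is_mderive_ext m n (g h : R -> 'M[C]_(m, n)) t L :
  g =1 h -> is_mderive g t L -> is_mderive h t L.
Proof. by move=> /funext ->. Qed.

Lemma is_mderive_cst m n (M : 'M[C]_(m, n)) t : is_mderive (fun=> M) t 0.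
Proof. by move=> i j; rewrite mxE; exact: is_cderive_cst. Qed.

Lemma is_mderiveD m n (f h : R -> 'M[C]_(m, n)) t L M :
  is_mderive f t L -> is_mderive h t M -> is_mderive (fun s => f s + h s) t (L + M).
Proof.
move=> hf hh i j; rewrite mxE; under eq_fun do rewrite mxE; exact: is_cderiveD.
Qed.

Lemma is_mderiveM m n p (g : R -> 'M[C]_(m, n)) (h : R -> 'M[C]_(n, p)) t L M :
  is_mderive g t L -> is_mderive h t M ->
  is_mderive (fun s => g s *m h s) t (L *m h t + g t *m M).
Proof.
move=> hg hh i j; under eq_fun do rewrite mxE.
rewrite !mxE -big_split /=; apply: is_cderive_sum => l; exact: is_cderiveM.
Qed.

Lemma is_mderiveMl m n p (X : 'M[C]_(m, n)) (h : R -> 'M[C]_(n, p)) t M :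
  is_mderive h t M -> is_mderive (fun s => X *m h s) t (X *m M).
Proof.
move=> /(is_mderiveM (is_mderive_cst X t)) /is_mderive_eq; apply.
by rewrite mul0mx add0r.
Qed.

Lemma is_mderiveMr m n p (g : R -> 'M[C]_(m, n)) (X : 'M[C]_(n, p)) t L :
  is_mderive g t L -> is_mderive (fun s => g s *m X) t (L *m X).
Proof.
move=> /is_mderiveM /(_ (is_mderive_cst X t)) /is_mderive_eq; apply.
by rewrite mulmx0 addr0.
Qed.

Lemma is_mderiveZ m n (f : R -> R) (df : R) (X : 'M[C]_(m, n)) (t : R) :
  is_derive t 1 f df -> is_mderive (fun s => (f s)%:C *: X) t (df%:C *: X).
Proof.
move=> hf i j; rewrite mxE; under eq_fun do rewrite mxE.
have := @is_cderiveM (fun s => (f s)%:C) (fun=> X i j) t (df%:C) 0.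
rewrite mulr0 addr0; apply; last exact: is_cderive_cst.
by split => //=; exact: is_derive_cst.
Qed.

Lemma is_cderive_tr n (g : R -> 'M[C]_n) t L : is_mderive g t L ->
  is_cderive (fun s => \tr (g s)) t (\tr L).
Proof. by move=> h; apply: is_cderive_sum => i; exact: h. Qed.

Lemma is_mderive_rsubmx m n p (g : R -> 'M[C]_(m, n + p)) t L : is_mderive g t L ->
  is_mderive (fun s => rsubmx (g s)) t (rsubmx L).
Proof. by move=> h i j; under eq_fun do rewrite mxE; rewrite mxE; exact: h. Qed.

Lemma is_mderive_derivable m n (g : R -> 'M[C]_(m, n)) t L :
  is_mderive g t L -> derivable_curve g t.
Proof. by move=> h i j; have [h1 h2] := h i j; split; exact: ex_derive. Qed.

Lemma is_mderive_velocity m n (g : R -> 'M[C]_(m, n)) t L :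
  is_mderive g t L -> velocity g t = L.
Proof.
move=> h; apply/matrixP => i j; rewrite mxE !derive1E; have [h1 h2] := h i j.
rewrite /re_coord /im_coord !derive_val; by case: (L i j).
Qed.

(** A derivative is also the right derivative, so it only depends on the values
    to the right of the point. This is what lets two curves that agree on
    [0, T] be compared at time 0, although their derivatives are two-sided. *)
Lemma right_derive_uniq (f h : R -> R) (a b l m : R) : a < b ->
  (forall x, a <= x <= b -> f x = h x) ->
  is_derive a 1 f l -> is_derive a 1 h m -> l = m.
Proof.
move=> ab fh fl hm.
have cv (u : R -> R) (d : R) : is_derive a 1 u d ->
    (fun e => e^-1 *: (u (e *: 1 + a) - u a)) @ 0^'+ --> d.
  move=> ud; apply: cvg_dnbhs_at_right.
  have D : derivable u a 1 := @ex_derive _ _ _ _ _ _ _ ud.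
  by have <- : 'D_1 u a = d := @derive_val _ _ _ _ _ _ _ ud.
apply: (cvg_unique (@Rhausdorff R) (cv _ _ fl)); apply: cvg_trans (cv _ _ hm).
apply: near_eq_cvg; near=> e.
have e0 : 0 < e by near: e; exact: nbhs_right_gt.
have eb : e < b - a by near: e; apply: nbhs_right_lt; rewrite subr_gt0.
rewrite !fh ?lexx ?(ltW ab) //.
rewrite /GRing.scale /= mulr1; apply/andP; split; lra.
Unshelve. all: by end_near. Qed.

Lemma right_mderive_uniq m n (f h : R -> 'M[C]_(m, n)) (a b : R) L M : a < b ->
  (forall x, a <= x <= b -> f x = h x) ->
  is_mderive f a L -> is_mderive h a M -> L = M.
Proof.
move=> ab fh fL hM; apply/matrixP => i j; have [f1 f2] := fL i j; have [h1 h2] := hM i j.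
apply/eqP; rewrite eq_complex; apply/andP; split; apply/eqP.
- by apply: right_derive_uniq ab _ f1 h1 => x /fh ->.
- by apply: right_derive_uniq ab _ f2 h2 => x /fh ->.
Qed.

Definition expi (x : R) : C := cos x +i* sin x.

Lemma is_cderive_expi (d t : R) :
  is_cderive (fun s => expi (s * d)) t ('i%C * d%:C * expi (t * d)).
Proof.
have hd : is_derive t 1 (fun s : R => s * d) d.
  rewrite (_ : (fun s => _) = d *: id).
    by apply: is_derive_eq; rewrite /GRing.scale /= mulr1.
  by apply/funext => s /=; rewrite mulrC.
split.
- apply: is_derive_eq (is_derive1_comp (is_derive_cos _) hd) _ => /=; ring.
- apply: is_derive_eq (is_derive1_comp (is_derive_sin _) hd) _ => /=; ring.
Qed.

Lemma expi_unit (x : R) : Num.conj (expi x) * expi x = 1.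
Proof.
apply/eqP; rewrite eq_complex; apply/andP; split; apply/eqP.
- by rewrite /= -(cos2Dsin2 x); ring.
- by rewrite /=; ring.
Qed.

End ComplexCurves.

(** * The exponential of a skew-Hermitian matrix *)

Section SpectralForm.
Variable K : numClosedFieldType.

Lemma adjmxM m n p (A : 'M[K]_(m, n)) (B : 'M[K]_(n, p)) : (A *m B)^t* = B^t* *m A^t*.
Proof. by rewrite trmx_mul map_mxM. Qed.

Lemma adjmxN m n (A : 'M[K]_(m, n)) : (- A)^t* = - A^t*.
Proof. by apply/matrixP => i j; rewrite !mxE rmorphN. Qed.

Lemma adjmx0 m n : (0 : 'M[K]_(m, n))^t* = 0.
Proof. by rewrite trmx0 map_mx0. Qed.

Lemma adjmx1 n : (1%:M : 'M[K]_n)^t* = 1%:M.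
Proof. by rewrite trmx1 map_mx1. Qed.

Lemma unitarymxl n (U : 'M[K]_n) : U \is unitarymx -> U^t* *m U = 1%:M.
Proof. by move=> /unitarymxP h; exact: mulmx1C. Qed.

Lemma unitarymxr n (U : 'M[K]_n) : U \is unitarymx -> U *m U^t* = 1%:M.
Proof. by move=> /unitarymxP. Qed.

Lemma unitarymxI n (U : 'M[K]_n) : U^t* *m U = 1%:M -> U \is unitarymx.
Proof. by move=> h; apply/unitarymxP; exact: mulmx1C. Qed.

Lemma block_adjmx m n p r (A : 'M[K]_(m, n)) (B : 'M[K]_(m, p))
    (D : 'M[K]_(r, n)) (E : 'M[K]_(r, p)) :
  (block_mx A B D E)^t* = block_mx (A^t*) (D^t*) (B^t*) (E^t*).
Proof. by rewrite tr_block_mx map_block_mx. Qed.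

Lemma block_unitary m n (U : 'M[K]_m) : U \is unitarymx ->
  block_mx U 0 0 (1%:M : 'M[K]_n) \is unitarymx.
Proof.
move=> uU; apply: unitarymxI; rewrite tr_block_mx map_block_mx !adjmx0 adjmx1.
by rewrite mulmx_block !mul0mx !mulmx0 !addr0 !add0r mulmx1 unitarymxl // -scalar_mx_block.
Qed.

Definition sdiag n (U : 'M[K]_n) (d : 'rV[K]_n) : 'M[K]_n := U^t* *m diag_mx d *m U.

Lemma sdiagZ n (U : 'M[K]_n) (d : 'rV[K]_n) a : a *: sdiag U d = sdiag U (a *: d).
Proof. by rewrite /sdiag linearZ /= -scalemxAr -scalemxAl. Qed.

Lemma sdiagM n (U : 'M[K]_n) (d e : 'rV[K]_n) : U \is unitarymx ->
  sdiag U d *m sdiag U e = sdiag U (\row_j (d 0 j * e 0 j)).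
Proof.
move=> uU; rewrite /sdiag !mulmxA mulmxtVK // -mulmx_diag.
by rewrite !mulmxA.
Qed.

Lemma sdiagC n (U : 'M[K]_n) (d e : 'rV[K]_n) : U \is unitarymx ->
  sdiag U d *m sdiag U e = sdiag U e *m sdiag U d.
Proof.
move=> uU; rewrite !sdiagM //; congr sdiag.
by apply/rowP => j; rewrite !mxE mulrC.
Qed.

Lemma sdiag1 n (U : 'M[K]_n) (d : 'rV[K]_n) : U \is unitarymx ->
  (forall j, d 0 j = 1) -> sdiag U d = 1%:M.
Proof.
move=> uU d1; rewrite /sdiag (_ : d = const_mx 1); last by apply/rowP => j; rewrite d1 mxE.
by rewrite diag_const_mx mulmx1 unitarymxl.
Qed.

Lemma sdiagX n (U : 'M[K]_n) (d : 'rV[K]_n) p : U \is unitarymx ->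
  sdiag U d ^+ p = sdiag U (\row_j d 0 j ^+ p).
Proof.
move=> uU; elim: p => [|p IH].
  by rewrite expr0 sdiag1 // => j; rewrite mxE expr0.
rewrite exprS IH -[LHS]/(sdiag U d *m sdiag U _) sdiagM //; congr sdiag.
by apply/rowP => j; rewrite !mxE exprS.
Qed.

Lemma sdiag_unitary n (U : 'M[K]_n) (d : 'rV[K]_n) : U \is unitarymx ->
  (forall j, Num.conj (d 0 j) * d 0 j = 1) -> sdiag U d \is unitarymx.
Proof.
move=> uU d1; apply: unitarymxI.
have -> : (sdiag U d)^t* = sdiag U (\row_j Num.conj (d 0 j)).
  rewrite /sdiag !adjmxM trmxCK mulmxA tr_diag_mx map_diag_mx.
  by congr (_ *m diag_mx _ *m _); apply/rowP => j; rewrite !mxE.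
by rewrite sdiagM // sdiag1 // => j; rewrite !mxE.
Qed.

Lemma sdiag_block m n (U : 'M[K]_m) (d : 'rV[K]_m) (e : 'rV[K]_n) :
  sdiag (block_mx U 0 0 1%:M) (row_mx d e) = block_mx (sdiag U d) 0 0 (diag_mx e).
Proof.
rewrite /sdiag diag_mx_row tr_block_mx map_block_mx !adjmx0 adjmx1.
by rewrite !mulmx_block !(mul0mx, mulmx0, addr0, add0r, mulmx1, mul1mx).
Qed.

Lemma scale_block_sdiag m n (U : 'M[K]_m) (d : 'rV[K]_m) a :
  a *: block_mx (sdiag U d) 0 0 (0 : 'M[K]_n) =
  sdiag (block_mx U 0 0 1%:M) (row_mx (a *: d) 0).
Proof. by rewrite sdiag_block scale_block_mx sdiagZ !scaler0 linear0. Qed.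

(** A skew-Hermitian matrix is normal, hence unitarily diagonalizable; its
    diagonal form is again skew-Hermitian, which makes the eigenvalues
    imaginary. *)
Lemma skew_spectral n (V : 'M[K]_n) : V^t* = - V ->
  exists U d, [/\ U \is unitarymx, V = sdiag U d & forall j, Num.conj (d 0 j) = - d 0 j].
Proof.
move=> skV; have uU := spectral_unitarymx V.
have /orthomx_spectralP : V \is normalmx.
  by apply/normalmxP; rewrite skV mulmxN mulNmx.
rewrite invmx_unitary //; set U := spectralmx V in uU *; set D := spectral_diag V => VE.
exists U, D; split => // j.
have DE : diag_mx D = U *m V *m U^t*.
  by rewrite VE !mulmxA unitarymxr // mul1mx mulmxtVK.
have : (diag_mx D)^t* = - diag_mx D.
  by rewrite DE !adjmxM trmxCK skV mulNmx mulmxN mulmxA.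
by move=> /matrixP/(_ j j); rewrite !mxE eqxx !mulr1n.
Qed.

End SpectralForm.

Section MatrixLimits.
Variable K : numFieldType.

Lemma cvg_mx m n (F : nat -> 'M[K]_(m, n)) (L : 'M[K]_(m, n)) :
  (forall i j, (fun p => F p i j) @ \oo --> L i j) -> F @ \oo --> L.
Proof.
move=> h; apply/cvg_ballP => e e0; near=> p; split => //.
near: p; apply: filter_forall => i; apply: filter_forall => j.
by have /cvg_ballP := h i j; apply.
Unshelve. all: by end_near. Qed.

Lemma cvg_sum_finType (I : finType) (u : I -> nat -> K) (l : I -> K) :
  (forall i, u i @ \oo --> l i) ->
  (fun N => \sum_i u i N) @ \oo --> \sum_i l i.
Proof.
move=> h; elim: (index_enum I) => [|i r IH].
  by under eq_fun do rewrite big_nil; rewrite big_nil; exact: cvg_cst.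
under eq_fun do rewrite big_cons.
by rewrite big_cons; apply: cvgD => //; exact: h.
Qed.

Lemma cvg_mulmx_diag m n p (A : 'M[K]_(m, n)) (B : 'M[K]_(n, p))
    (u : nat -> 'rV[K]_n) (l : 'rV[K]_n) :
  (forall j, (fun N => u N 0 j) @ \oo --> l 0 j) ->
  (fun N => A *m diag_mx (u N) *m B) @ \oo --> A *m diag_mx l *m B.
Proof.
move=> h; apply: cvg_mx => i j; rewrite mxE.
under eq_fun do rewrite mxE.
apply: cvg_sum_finType => r; rewrite mul_mx_diag mxE.
under eq_fun do rewrite mul_mx_diag mxE.
by apply: cvgMl; apply: cvgMr; exact: h.
Qed.

End MatrixLimits.

(** Conjugation by a unitary matrix is continuous and multiplicative, so the
    exponential series of a diagonalized matrix converges as soon as the scalar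
    series of its eigenvalues do. *)
Lemma expmx_sdiag (K : numClosedFieldType) n
    (U : 'M[K]_n) (d e : 'rV[K]_n) : U \is unitarymx ->
  (forall j, series (fun p : nat => (p`!%:R)^-1 * d 0 j ^+ p) @ \oo --> e 0 j) ->
  expmx (sdiag U d) = sdiag U e.
Proof.
move=> uU de; apply: cvg_lim; first exact: norm_hausdorff.
rewrite (_ : series _ = fun N => sdiag U (\row_j
   series (fun p : nat => (p`!%:R)^-1 * d 0 j ^+ p) N)).
  by rewrite /sdiag; apply: cvg_mulmx_diag => j; under eq_fun do rewrite mxE; exact: de.
apply/funext => N; rewrite /series /=.
under eq_bigr do rewrite sdiagX // sdiagZ.
rewrite /sdiag -mulmx_suml -mulmx_sumr -linear_sum; congr (_ *m diag_mx _ *m _).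
apply/rowP => j; rewrite summxE mxE; apply: eq_bigr => p _.
by rewrite !mxE.
Qed.

Section SkewExponential.
Variable R : realType.
Notation C := R[i].

Lemma normc_real (x : R) : `|x%:C| = `|x|%:C :> C.
Proof. by rewrite normc_def /= expr0n addr0 sqrtr_sqr. Qed.

Lemma normc_i : `|'i%C| = 1 :> C.
Proof. by rewrite normc_def /= expr0n expr1n add0r sqrtr1. Qed.

Lemma normc_lt (z : C) (e : R) :
  `|complex.Re z| < e / 2 -> `|complex.Im z| < e / 2 -> `|z| < e%:C.
Proof.
move=> hr hi; rewrite [z]complexE; apply: le_lt_trans (ler_normD _ _) _.
rewrite normrM normc_i mul1r !normc_real -rmorphD ltcR.
by rewrite [ltRHS]splitr ltrD.
Qed.

(** The topology of C is the one given by its modulus, not a product topology,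
    so convergence of both real coordinates has to be transferred. *)
Lemma cvg_complex (u : nat -> C) (l : C) :
  (fun n => complex.Re (u n)) @ \oo --> complex.Re l ->
  (fun n => complex.Im (u n)) @ \oo --> complex.Im l ->
  u @ \oo --> (l : (C : numFieldType)).
Proof.
move=> /cvgrPdist_lt hr /cvgrPdist_lt hi.
apply/(@cvgrPdist_lt (C : numFieldType) (C : numFieldType)) => e e0.
have [e' eE] : exists e', e = e'%:C.
  exists (complex.Re e); move: (e : C) e0 => [x y]; rewrite ltcE.
  by move=> /andP[/eqP /= ->].
move: e0; rewrite eE ltcR => e0.
have e2 : 0 < e' / 2 by rewrite divr_gt0.
near=> n.
apply: normc_lt; rewrite raddfB; near: n; [exact: hr | exact: hi].
Unshelve. all: by end_near. Qed.

Lemma exp_imag_coeff (x : R) (p : nat) :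
  (p`!%:R)^-1 * ('i%C * x%:C) ^+ p = cos_coeff x p +i* sin_coeff x p :> C.
Proof.
have -> : ('i%C * x%:C) ^+ p = (('i%C : C) ^+ p) * (x ^+ p)%:C.
  by rewrite exprMn rmorphXn.
have -> : ((p`!%:R : C)^-1) = ((p`!%:R : R)^-1)%:C by rewrite fmorphV rmorph_nat.
have -> : ('i%C : C) ^+ p = ((~~ odd p)%:R * (-1) ^+ p./2) +i* ((odd p)%:R * (-1) ^+ p.-1./2).
  rewrite -{1}(odd_double_half p) exprD -mul2n exprM sqr_i.
  have -> : ((-1 : C) ^+ p./2) = ((-1) ^+ p./2)%:C by rewrite rmorphXn rmorphN1.
  case: (boolP (odd p)) => hp /=.
    have -> : p.-1./2 = p./2 by rewrite -{1}(odd_double_half p) hp /= doubleK.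
    by rewrite expr1; apply/eqP; rewrite eq_complex /=; apply/andP; split; apply/eqP; ring.
  by rewrite expr0; apply/eqP; rewrite eq_complex /=; apply/andP; split; apply/eqP; ring.
apply/eqP; rewrite eq_complex /= /cos_coeff /sin_coeff /= -?exprnP.
by apply/andP; split; apply/eqP; ring.
Qed.

Lemma cvg_exp_imag (x : R) :
  series (fun p : nat => (p`!%:R)^-1 * ('i%C * x%:C) ^+ p : C) @ \oo
  --> (expi x : (C : numFieldType)).
Proof.
apply: cvg_complex.
- rewrite (_ : (fun n => _) = series (cos_coeff x)).
    by rewrite /= unlock; exact: is_cvg_series_cos_coeff.
  apply/funext => n; rewrite /series /= raddf_sum /=; apply: eq_bigr => i _.
  by rewrite exp_imag_coeff.
- rewrite (_ : (fun n => _) = series (sin_coeff x)).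
    by rewrite /= unlock; exact: is_cvg_series_sin_coeff.
  apply/funext => n; rewrite /series /= raddf_sum /=; apply: eq_bigr => i _.
  by rewrite exp_imag_coeff.
Qed.

Lemma expmx_skew n (V : 'M[C]_n) : V^t* = - V ->
  exists (U : 'M[C]_n) (x : 'I_n -> R),
    [/\ U \is unitarymx, V = sdiag U (\row_j ('i%C * (x j)%:C)) &
        forall t : R, expmx (t%:C *: V) = sdiag U (\row_j expi (t * x j))].
Proof.
move=> /skew_spectral [U [d [uU VE dI]]].
have dE : d = \row_j ('i%C * (complex.Im (d 0 j))%:C).
  apply/rowP => j; rewrite mxE; have := congr1 (@complex.Re R) (dI j).
  rewrite Re_conjC; case: (d 0 j) => a b /= aE.
  by apply/eqP; rewrite eq_complex /=; apply/andP; split; apply/eqP; lra.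
exists U, (fun j => complex.Im (d 0 j)); split; [exact: uU | exact: etrans VE (congr1 _ dE) |].
move=> t; rewrite VE sdiagZ; apply: (expmx_sdiag uU) => j; rewrite !mxE {1}dE mxE.
rewrite mulrCA -rmorphM; exact: cvg_exp_imag.
Qed.

Lemma expmx_skew_unitary n (V : 'M[C]_n) (t : R) : V^t* = - V ->
  expmx (t%:C *: V) \is unitarymx.
Proof.
move=> /expmx_skew [U [x [uU _ ->]]]; apply: (sdiag_unitary uU) => j.
by rewrite mxE; exact: expi_unit.
Qed.

Lemma expmx_skew0 n (V : 'M[C]_n) : V^t* = - V -> expmx ((0 : R)%:C *: V) = 1%:M.
Proof.
move=> /expmx_skew [U [x [uU _ ->]]]; apply: (sdiag1 uU) => j.
by rewrite mxE mul0r /expi cos0 sin0.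
Qed.

Lemma expmx_skew_comm n (V : 'M[C]_n) (t : R) : V^t* = - V ->
  V *m expmx (t%:C *: V) = expmx (t%:C *: V) *m V.
Proof.
by move=> /expmx_skew [U [x [uU VE ->]]]; rewrite {1 2}VE; exact: sdiagC uU.
Qed.

Lemma is_mderive_expmx n (V : 'M[C]_n) (t : R) : V^t* = - V ->
  is_mderive (fun s => expmx (s%:C *: V)) t (expmx (t%:C *: V) *m V).
Proof.
move=> /expmx_skew [U [x [uU VE E]]]; under eq_fun do rewrite E.
rewrite E {1}VE (sdiagM _ _ uU); apply: is_mderiveMr; apply: is_mderiveMl => i j.
rewrite !mxE; under eq_fun do rewrite !mxE.
case: eqP => _; rewrite ?mulr1n ?mulr0n; last exact: is_cderive_cst.
by rewrite mulrC; exact: is_cderive_expi.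
Qed.

(** A unitary diagonalization of A, completed by the identity, diagonalizes the
    block matrix; the added eigenvalues are 0, with exponential 1. *)
Lemma expmx_block n m (A : 'M[C]_n) (t : R) : A^t* = - A ->
  expmx (t%:C *: block_mx A 0 0 (0 : 'M[C]_m)) = block_mx (expmx (t%:C *: A)) 0 0 1%:M.
Proof.
move=> /expmx_skew [U [x [uU AE ->]]].
rewrite {1}AE scale_block_sdiag.
rewrite (expmx_sdiag (e := row_mx (\row_j expi (t * x j)) (const_mx 1)) (block_unitary _ uU)).
  by rewrite sdiag_block diag_const_mx.
move=> j; rewrite !mxE; case: splitP => i _; rewrite !mxE.
  rewrite mulrCA -rmorphM; exact: cvg_exp_imag.
have := @cvg_exp_imag 0; rewrite rmorph0 mulr0 (_ : expi 0 = 1); first exact.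
by rewrite /expi cos0 sin0.
Qed.

End SkewExponential.

(** * Rigidity of great circles *)

Section RealDot.
Variable R : realType.
Notation C := R[i].

Definition rdot m n (X Y : 'M[C]_(m, n)) : R := complex.Re (\tr (X^t* *m Y)).

Lemma rdotE m n (X Y : 'M[C]_(m, n)) : rdot X Y =
  \sum_j \sum_i (complex.Re (X i j) * complex.Re (Y i j) +
                  complex.Im (X i j) * complex.Im (Y i j)).
Proof.
rewrite /rdot /mxtrace Re_sum; apply: eq_bigr => j _.
rewrite mxE Re_sum; apply: eq_bigr => i _.
by rewrite !mxE Re_mul Re_conjC Im_conjC mulNr opprK.
Qed.

Lemma rdotC m n (X Y : 'M[C]_(m, n)) : rdot X Y = rdot Y X.
Proof.
rewrite !rdotE; apply: eq_bigr => j _; apply: eq_bigr => i _.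
by rewrite mulrC [X in _ + X]mulrC.
Qed.

Lemma rdotDr m n (X Y Z : 'M[C]_(m, n)) : rdot X (Y + Z) = rdot X Y + rdot X Z.
Proof. by rewrite /rdot mulmxDr mxtraceD Re_add. Qed.

Lemma rdotDl m n (X Y Z : 'M[C]_(m, n)) : rdot (Y + Z) X = rdot Y X + rdot Z X.
Proof. by rewrite rdotC rdotDr !(rdotC X). Qed.

Lemma rdotZr m n (a : R) (X Y : 'M[C]_(m, n)) : rdot X (a%:C *: Y) = a * rdot X Y.
Proof. by rewrite /rdot -scalemxAr mxtraceZ Re_mul /= mul0r subr0. Qed.

Lemma rdotZl m n (a : R) (X Y : 'M[C]_(m, n)) : rdot (a%:C *: X) Y = a * rdot X Y.
Proof. by rewrite rdotC rdotZr rdotC. Qed.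

Lemma rdotNr m n (X Y : 'M[C]_(m, n)) : rdot X (- Y) = - rdot X Y.
Proof. by rewrite -[- Y]scaleN1r -(rmorphN1 (real_complex R)) rdotZr mulN1r. Qed.

Lemma rdotNl m n (X Y : 'M[C]_(m, n)) : rdot (- X) Y = - rdot X Y.
Proof. by rewrite rdotC rdotNr rdotC. Qed.

Lemma rdot_ge0 m n (X : 'M[C]_(m, n)) : 0 <= rdot X X.
Proof.
rewrite rdotE; apply: sumr_ge0 => j _; apply: sumr_ge0 => i _.
by rewrite addr_ge0 // -expr2 sqr_ge0.
Qed.

Lemma rdot_eq0 m n (X : 'M[C]_(m, n)) : rdot X X = 0 -> X = 0.
Proof.
have h i j : 0 <= complex.Re (X i j) * complex.Re (X i j) +
                  complex.Im (X i j) * complex.Im (X i j).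
  by rewrite addr_ge0 // -expr2 sqr_ge0.
rewrite rdotE => /psumr_eq0P E; apply/matrixP => i j; rewrite mxE.
have /psumr_eq0P /(_ i isT) :
    \sum_i (complex.Re (X i j) * complex.Re (X i j) +
            complex.Im (X i j) * complex.Im (X i j)) = 0.
  by apply: E => // l _; exact: sumr_ge0.
move=> /(_ (fun i _ => h i j)) /eqP.
rewrite -!expr2 paddr_eq0 ?sqr_ge0 // !sqrf_eq0 => /andP[/eqP a /eqP b].
by case: (X i j) a b => x y /= -> ->.
Qed.

Lemma rdot_entry m n (X : 'M[C]_(m, n)) i j :
  complex.Re (X i j) ^+ 2 + complex.Im (X i j) ^+ 2 <= rdot X X.
Proof.
have h a b : 0 <= complex.Re (X a b) * complex.Re (X a b) +
                  complex.Im (X a b) * complex.Im (X a b).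
  by rewrite addr_ge0 // -expr2 sqr_ge0.
rewrite rdotE (bigD1 j) //= (bigD1 i) //= -!expr2 -addrA lerDl addr_ge0 ?sumr_ge0 //.
by move=> a _; rewrite sumr_ge0.
Qed.

Lemma rdot_cauchy m n (X Y : 'M[C]_(m, n)) : rdot X Y ^+ 2 <= rdot X X * rdot Y Y.
Proof.
have [Y0|Yn0] := eqVneq (rdot Y Y) 0.
  have -> : rdot X Y = 0 by rewrite (rdot_eq0 Y0) -(scale0r 0) (rdotZr 0) mul0r.
  by rewrite expr0n Y0 mulr0.
have Yp : 0 < rdot Y Y by rewrite lt_def Yn0 rdot_ge0.
have := rdot_ge0 ((rdot Y Y)%:C *: X + (- rdot X Y)%:C *: Y).
rewrite !rdotDl !rdotDr !rdotZl !rdotZr (rdotC Y X).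
set a := rdot Y Y in Yp *; set b := rdot X Y; set c := rdot X X => h.
have : 0 <= a * (c * a - b ^+ 2).
  by apply: le_trans h _; rewrite le_eqVlt; apply/orP; left; apply/eqP; ring.
by rewrite pmulr_rge0 // subr_ge0.
Qed.

Lemma rdot_adjmx m n (X : 'M[C]_(m, n)) : rdot (X^t*) (X^t*) = rdot X X.
Proof. by rewrite /rdot adjmxK mxtrace_mulC. Qed.

Lemma rdot_mulmxl m n p (Y : 'M[C]_(m, n)) (X Z : 'M[C]_(n, p)) : Y^t* *m Y = 1%:M ->
  rdot (Y *m X) (Y *m Z) = rdot X Z.
Proof. by move=> h; rewrite /rdot trmx_mul map_mxM -mulmxA (mulmxA _ Y) h mul1mx. Qed.

Lemma is_derive_rdot m n (u : R -> 'M[C]_(m, n)) (du p : 'M[C]_(m, n)) t :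
  is_mderive u t du -> is_derive t 1 (fun s => rdot (u s) p) (rdot du p).
Proof.
move=> h; rewrite rdotC; under eq_fun do rewrite rdotC.
by have [] := is_cderive_tr (is_mderiveMl (p^t*) h).
Qed.

End RealDot.

Section GreatCircle.
Variable R : realType.
Notation C := R[i].

Lemma lipschitz_of_derive (f df : R -> R) (c : R) :
  (forall x : R, is_derive x 1 f (df x)) -> (forall x, `|df x| <= c) ->
  forall s t, `|f t - f s| <= c * `|t - s|.
Proof.
move=> fd dc.
have cf : continuous f.
  move=> x; apply/differentiable_continuous/derivable1_diffP.
  exact: (@ex_derive _ _ _ _ _ _ _ (fd x)).
have h s t : s <= t -> `|f t - f s| <= c * `|t - s|.
  move=> st.
  have [|r _ ->] := MVT_segment st (fun x _ => fd x); first exact: continuous_subspaceT.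
  by rewrite normrM ler_wpM2r.
move=> s t; have [st|ts] := leP s t; first exact: h.
by rewrite distrC (distrC t); apply: h; exact: ltW.
Qed.

(** The differential inequality says that the angle acos (f x) is c-Lipschitz.
    As acos is not differentiable at 1 and -1, which f may reach, f is first
    multiplied by r = cos e < 1; the conclusion for f follows as e tends to 0. *)
Lemma cos_comparison (f df : R -> R) (c s t : R) :
  (forall x : R, is_derive x 1 f (df x)) -> 0 <= c ->
  (forall x, f x ^+ 2 <= 1) ->
  (forall x, df x ^+ 2 <= c ^+ 2 * (1 - f x ^+ 2)) ->
  f s = 1 -> c * `|t - s| <= pi / 2 -> cos (c * `|t - s|) <= f t.
Proof.
move=> fd c0 f1 dfc fs1 cts; set a := c * _ in cts *.
have a0 : 0 <= a by rewrite mulr_ge0.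
have pi0 : 0 < (pi : R) := pi_gt0 R.
have main (e : R) : 0 < e -> e < pi / 2 -> cos (e + a) <= cos e * f t.
  move=> e0 epi.
  have r1 : cos e < 1 by rewrite -cos0 ltr_cos // in_itv /=; apply/andP; split; lra.
  have r0 : 0 < cos e by apply: cos_gt0_pihalf; lra.
  set r := cos e in r0 r1 *.
  have rf x : (r * f x) ^+ 2 < 1.
    rewrite exprMn; apply: le_lt_trans (ler_wpM2l (sqr_ge0 r) (f1 x)) _.
    by rewrite mulr1 expr_lt1 ?ltW.
  have rfI x : -1 < r * f x < 1.
    by rewrite -ltr_norml -(ltr_pXn2r (_ : 0 < 2)%N) ?nnegrE // expr1n real_normK ?num_real.
  have hd (x : R) : is_derive x 1 (acos \o (fun y => r * f y))
      (- (Num.sqrt (1 - (r * f x) ^+ 2))^-1 * (r * df x)).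
    have h1 : is_derive x 1 (fun y : R => r * f y) (r * df x) by exact: is_deriveZ.
    exact: (@is_derive1_comp _ acos (fun y : R => r * f y) _ _ _ (is_derive1_acos (rfI x)) h1).
  have hb x : `|- (Num.sqrt (1 - (r * f x) ^+ 2))^-1 * (r * df x)| <= c.
    have S0 : 0 < Num.sqrt (1 - (r * f x) ^+ 2) by rewrite sqrtr_gt0 subr_gt0.
    rewrite mulNr normrN normrM normfV (gtr0_norm S0) mulrC ler_pdivrMr //.
    rewrite -(ler_pXn2r (_ : 0 < 2)%N) ?nnegrE ?mulr_ge0 ?(ltW S0) //.
    rewrite real_normK ?num_real // !exprMn sqr_sqrtr; last by rewrite subr_ge0 -exprMn ltW.
    have r21 : r ^+ 2 <= 1 by rewrite expr_le1 ?ltW.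
    apply: le_trans (ler_wpM2l (sqr_ge0 r) (dfc x)) _.
    rewrite mulrCA ler_wpM2l ?sqr_ge0 // mulrBr mulr1 lerD2r //.
  have := lipschitz_of_derive hd hb s t; rewrite /= fs1 mulr1 -/a.
  have -> : acos r = e by rewrite cosK // in_itv /=; apply/andP; split; lra.
  move=> /ler_normlP[_]; rewrite lerBlDr addrC => le.
  have [x1 x2] := andP (rfI t).
  rewrite -[leRHS]acosK ?in_itv /= ?(ltW x1) ?(ltW x2) //.
  rewrite leNgt ltr_cos ?in_itv -?leNgt //=; first by apply/andP; split; lra.
  by rewrite acos_ge0 ?acos_lepi ?(ltW x1) ?(ltW x2).
rewrite leNgt; apply/negP => lt.
have cv : (fun e : R => cos (e + a) - cos e * f t) @ 0^'+ --> cos a - f t.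
  apply: cvg_at_right_filter.
  rewrite -{2}(add0r a) -{2}(mul1r (f t)) -cos0.
  apply: cvgB.
    apply: (@continuous_comp _ _ _ (fun e : R => e + a) cos); last exact: continuous_cos.
    by apply: cvgD; [exact: cvg_id|exact: cvg_cst].
  by apply: cvgMl; exact: continuous_cos.
have Q : \forall e \near (0:R)^'+, 0 < cos (e + a) - cos e * f t.
  by apply: (cvgr_gt _ cv); rewrite subr_gt0.
have : \forall e \near (0:R)^'+, False.
  near=> e.
  have e0 : 0 < e by near: e; exact: nbhs_right_gt.
  have e1 : e < pi / 2 by near: e; apply: nbhs_right_lt; rewrite divr_gt0.
  have : 0 < cos (e + a) - cos e * f t by near: e.
  by rewrite subr_gt0 ltNge main.
by move/filter_ex => [].
Unshelve. all: by end_near. Qed.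

(** The angle between u t and u 0 grows at rate at most c, so it is at most
    c t; likewise, the angle between u t and u T is at most
    c (T - t) = pi / 2 - c t. As u 0 and u T are orthogonal, the point
    w = cos (c t) u 0 + sin (c t) u T of the sphere then satisfies
    [rdot (u t) w >= N]. This is the equality case of Cauchy-Schwarz on the
    sphere, whence u t = w. *)
Lemma great_circle_of_orthogonal_ends m n (u du : R -> 'M[C]_(m, n)) (N c T : R) :
  0 < N -> 0 <= c -> c * T = pi / 2 ->
  (forall t, is_mderive u t (du t)) ->
  (forall t, rdot (u t) (u t) = N) ->
  (forall t, rdot (du t) (u t) = 0) ->
  (forall t, rdot (du t) (du t) <= c ^+ 2 * N) ->
  rdot (u T) (u 0) = 0 ->
  forall t, 0 <= t <= T ->
  u t = (cos (c * t))%:C *: u 0 + (sin (c * t))%:C *: u T.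
Proof.
move=> N0 c0 cT ud uN uo us u0T.
(* The cosine of the angle between u x and p is f x = rdot (u x) p / N. *)
have key p s t : rdot p p = N -> rdot (u s) p = N -> c * `|t - s| <= pi / 2 ->
    N * cos (c * `|t - s|) <= rdot (u t) p.
  move=> pN sp cts; rewrite mulrC -ler_pdivlMr //.
  apply: (@cos_comparison (fun x => rdot (u x) p / N) (fun x => rdot (du x) p / N)) => //.
  - move=> x; have := is_deriveZ N^-1 (is_derive_rdot p (ud x)).
    rewrite /GRing.scale /= mulrC.
    by rewrite (_ : N^-1 \*: _ = fun x => rdot (u x) p / N) //; apply/funext => y; rewrite /= mulrC.
  - move=> x; rewrite expr_div_n ler_pdivrMr ?exprn_gt0 // mul1r.
    by apply: le_trans (rdot_cauchy _ _) _; rewrite pN uN -expr2.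
  - move=> x; set f := rdot (u x) p / N.
    (* The velocity is tangent to the sphere, so p may be replaced by its
       component orthogonal to u x, of squared norm N (1 - f x ^+ 2). *)
    have -> : rdot (du x) p = rdot (du x) (p + (- f)%:C *: u x).
      by rewrite rdotDr rdotZr uo mulr0 addr0.
    rewrite expr_div_n ler_pdivrMr ?exprn_gt0 //.
    apply: le_trans (rdot_cauchy _ _) _.
    have -> : rdot (p + (- f)%:C *: u x) (p + (- f)%:C *: u x) = N * (1 - f ^+ 2).
      rewrite !rdotDl !rdotDr !rdotZl !rdotZr pN uN (rdotC p).
      have -> : rdot (u x) p = f * N by rewrite /f divfK ?gt_eqF.
      ring.
    have q0 : 0 <= N * (1 - f ^+ 2).
      apply: mulr_ge0; first exact: ltW.
      rewrite subr_ge0 /f expr_div_n ler_pdivrMr ?exprn_gt0 // mul1r.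
      by apply: le_trans (rdot_cauchy _ _) _; rewrite pN uN -expr2.
    apply: le_trans (ler_wpM2r q0 (us x)) _.
    by rewrite le_eqVlt; apply/orP; left; apply/eqP; ring.
  - by rewrite sp divff ?gt_eqF.
move=> t /andP[t0 tT].
set w := _ + _.
have wu : N <= rdot (u t) w.
  rewrite /w rdotDr !rdotZr.
  have ct : c * t <= pi / 2 by rewrite -cT ler_wpM2l.
  have ct0 : 0 <= c * t by rewrite mulr_ge0.
  have pi0 : 0 < (pi : R) := pi_gt0 R.
  have h1 : N * cos (c * t) <= rdot (u t) (u 0).
    have := key (u 0) 0 t (uN 0) (uN 0); rewrite subr0 ger0_norm //; exact.
  have h2 : N * sin (c * t) <= rdot (u t) (u T).
    have := key (u T) T t (uN T) (uN T); rewrite distrC ger0_norm ?subr_ge0 //.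
    rewrite mulrBr cT cosB cos_pihalf sin_pihalf mul0r mul1r add0r; apply; lra.
  have cg : 0 <= cos (c * t) by apply: cos_ge0_pihalf; lra.
  have sg : 0 <= sin (c * t) by apply: sin_ge0_pi; lra.
  have := lerD (ler_wpM2l cg h1) (ler_wpM2l sg h2); apply: le_trans.
  by rewrite -[leLHS]mulr1 -(cos2Dsin2 (c * t)) le_eqVlt; apply/orP; left; apply/eqP; ring.
apply/eqP; rewrite -subr_eq0; apply/eqP/rdot_eq0/eqP; rewrite eq_le rdot_ge0 andbT.
have ww : rdot w w = N.
  rewrite /w !rdotDl !rdotDr !rdotZl !rdotZr !uN u0T (rdotC (u 0)) u0T !mulr0 addr0 add0r.
  by rewrite !mulrA -mulrDl -!expr2 cos2Dsin2 mul1r.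
rewrite rdotDl !rdotDr !rdotNl !rdotNr uN ww (rdotC w); lra.
Qed.

End GreatCircle.

(** * Length of horizontal curves *)

Section Horizontal.
Variables (R : realType) (k : nat).
Notation C := R[i].

Lemma lipschitz_abs_cont (f : R -> R) (c a b : R) : 0 <= c ->
  (forall s t, `|f t - f s| <= c * `|t - s|) -> absolutely_continuous a b f.
Proof.
move=> c0 fc e e0; have c1 : 0 < c + 1 by rewrite ltr_wpDl.
(* Dividing by c + 1 covers the case c = 0. *)
exists (e / (c + 1)); first exact: divr_gt0.
move=> N l r lr _; rewrite ltr_pdivlMr // mulrC => lt; apply: le_lt_trans lt.
rewrite mulr_sumr; apply: ler_sum => i _; have [_ [lri _]] := lr i.
apply: le_trans (fc _ _) _; rewrite ger0_norm ?subr_ge0 //.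
by rewrite ler_wpM2r ?subr_ge0 // lerDl.
Qed.

Lemma stiefel_pi_hmx (q : 'M[C]_(k + k)) (X : 'M[C]_k) :
  stiefel_pi (q *m hmx X) = - (rsubmx q *m X^t*).
Proof.
by rewrite /stiefel_pi -{1}[q]hsubmxK mul_row_block row_mxKl mulmx0 add0r mulmxN.
Qed.

Lemma unitary_cols (q : 'M[C]_(k + k)) : q \is unitarymx ->
  [/\ (lsubmx q)^t* *m lsubmx q = 1%:M, (rsubmx q)^t* *m lsubmx q = 0 &
      (rsubmx q)^t* *m rsubmx q = 1%:M].
Proof.
move=> /unitarymxPl; rewrite -{1 2}[q]hsubmxK tr_row_mx map_col_mx mul_col_row.
by rewrite (@scalar_mx_block _ k k) => /eq_block_mx [].
Qed.

Lemma rdot_stiefel_pi (q : 'M[C]_(k + k)) : q \is unitarymx ->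
  rdot (stiefel_pi q) (stiefel_pi q) = k%:R.
Proof.
by move=> /unitary_cols[h _ _]; rewrite /rdot h mxtrace1 -(rmorph_nat (real_complex R)).
Qed.

Lemma rdot_hmx_stiefel_pi (q : 'M[C]_(k + k)) X : q \is unitarymx ->
  rdot (stiefel_pi (q *m hmx X)) (stiefel_pi q) = 0.
Proof.
move=> /unitary_cols[_ h _]; rewrite stiefel_pi_hmx rdotNl /rdot trmx_mul map_mxM -mulmxA h.
by rewrite mulmx0 raddf0 oppr0.
Qed.

Lemma rdot_hmx (q : 'M[C]_(k + k)) X : q \is unitarymx ->
  rdot (stiefel_pi (q *m hmx X)) (stiefel_pi (q *m hmx X)) = rdot X X.
Proof.
by move=> /unitary_cols[_ _ h]; rewrite stiefel_pi_hmx rdotNl rdotNr opprK rdot_mulmxl // rdot_adjmx.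
Qed.

(** With [rdot_hmx], the sub-Riemannian metric is a constant multiple of the
    Euclidean one. This is what makes the comparison with the sphere
    possible. *)
Lemma sr_inner_rdot (q : 'M[C]_(k + k)) X : q \is unitarymx ->
  sr_inner (stiefel_pi q) (stiefel_pi (q *m hmx X)) (stiefel_pi (q *m hmx X)) =
  4 * (k + k)%:R * rdot X X.
Proof.
move=> uq; rewrite sr_innerE // /hmx mulmx_block !mul0mx !mulmx0 !addr0 !add0r mxtrace_block.
rewrite mulmxN mulNmx [\tr (- (X *m _))]raddfN [\tr (- _)]raddfN /= [\tr (X *m _)]mxtrace_mulC.
have -> : - (2 * (k + k)%:R) = (- (2 * (k + k)%:R) : R)%:C :> C.
  by rewrite rmorphN rmorphM !rmorph_nat.
rewrite Re_mul mul0r subr0 Re_add !Re_opp /rdot /=; ring.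
Qed.

Variables (q : R -> 'M[C]_(k + k)) (B : R -> 'M[C]_k) (rho : R).
Hypothesis uq : forall t, q t \is unitarymx.
Hypothesis dq : forall t,
  is_mderive (fun s => stiefel_pi (q s)) t (stiefel_pi (q t *m hmx (B t))).
Hypothesis nB : forall t, rdot (B t) (B t) = rho.

Lemma lift_length (T : R) : 0 < T ->
  sr_length 0 T (fun t => stiefel_pi (q t)) = (Num.sqrt (4 * (k + k)%:R * rho) * T)%:E.
Proof.
move=> T0; rewrite /sr_length.
under eq_integral do rewrite (is_mderive_velocity (dq _)) sr_inner_rdot // nB.
by rewrite integral_cst //= lebesgue_measure_itv /= lte_fin T0 -EFinB subr0 -EFinM.
Qed.

(** The velocity has constant norm, so every real coordinate is Lipschitz, hence
    absolutely continuous. *)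
Lemma lift_horizontal_curve (T : R) : horizontal_curve 0 T (fun t => stiefel_pi (q t)).
Proof.
split.
- by move=> t _; exact: stiefel_pi_in.
- have rho0 : 0 <= rho by rewrite -(nB 0) rdot_ge0.
  have bd (x y : R) : x ^+ 2 + y ^+ 2 <= rho -> `|x| <= Num.sqrt rho /\ `|y| <= Num.sqrt rho.
    move=> h; rewrite -!sqrtr_sqr !ler_sqrt //.
    by split; apply: le_trans h; rewrite ?lerDl ?lerDr sqr_ge0.
  have bdt t i j : complex.Re (stiefel_pi (q t *m hmx (B t)) i j) ^+ 2 +
      complex.Im (stiefel_pi (q t *m hmx (B t)) i j) ^+ 2 <= rho.
    by rewrite -(nB t) -(rdot_hmx (B t) (uq t)); exact: rdot_entry.
  move=> i j; split; apply: (@lipschitz_abs_cont _ (Num.sqrt rho)) (sqrtr_ge0 _) _ => s t.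
  + apply: lipschitz_of_derive; first by move=> x; have [h _] := dq x i j; exact: h.
    by move=> x; have [] := bd _ _ (bdt x i j).
  + apply: lipschitz_of_derive; first by move=> x; have [_ h] := dq x i j; exact: h.
    by move=> x; have [] := bd _ _ (bdt x i j).
- apply: aeW => t _; split; first exact: is_mderive_derivable (dq t).
  by rewrite (is_mderive_velocity (dq t)); exists (q t), (B t).
Qed.

End Horizontal.

(** * Lifts of normal geodesics *)

Section BlockAlgebra.
Variables (K : numClosedFieldType) (k : nat).
Implicit Types A B G Q : 'M[K]_k.

Lemma skew_block A B : A^t* = - A ->
  (block_mx A B (- B^t*) 0)^t* = - block_mx A B (- B^t*) (0 : 'M[K]_k).
Proof.
by move=> skA; rewrite block_adjmx skA opp_block_mx adjmxN trmxCK opprK oppr0 adjmx0.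
Qed.

Lemma lsubmx_mul_block (E : 'M[K]_(k + k)) G :
  lsubmx (E *m block_mx G 0 0 1%:M) = E *m col_mx G 0.
Proof. by rewrite block_mxEh mul_mx_row row_mxKl. Qed.

Lemma rsubmx_mul_block (E : 'M[K]_(k + k)) G :
  rsubmx (E *m block_mx G 0 0 1%:M) = rsubmx E.
Proof.
by rewrite block_mxEh mul_mx_row row_mxKr -{1}[E]hsubmxK mul_row_col mulmx0 add0r mulmx1.
Qed.


(** The left side is the derivative of the first block column of E diag (G, I)
    when E' = E v and G' = - G A. The contributions of A cancel because A
    commutes with G; what remains comes from the lower half of v. *)
Lemma lsubmx_velocity (E : 'M[K]_(k + k)) A B G : A *m G = G *m A ->
  E *m block_mx A B (- B^t*) 0 *m col_mx G 0 + E *m col_mx (G *m - A) 0 =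
  - (rsubmx E *m (B^t* *m G)).
Proof.
move=> AG; rewrite -mulmxA -mulmxDr mul_block_col !mulmx0 !addr0 AG.
rewrite add_col_mx mulmxN subrr addr0 -{1}[E]hsubmxK mul_row_col mulmx0 add0r.
by rewrite mulNmx mulmxN.
Qed.

Lemma rsubmx_acceleration A B :
  rsubmx (block_mx A B (- B^t*) 0) *m - B^t* + rsubmx 1%:M *m (- B^t* *m - A) =
  col_mx (- (B *m B^t*)) (B^t* *m A).
Proof.
rewrite block_mxEh row_mxKr (@scalar_mx_block _ k k) block_mxEh row_mxKr.
rewrite !mul_col_mx add_col_mx !mul0mx !mul1mx addr0 add0r.
by rewrite mulmxN mulNmx mulmxN opprK.
Qed.

Lemma great_arc_unitary Q (a b : K) : Q \is unitarymx ->
  Num.conj a = a -> Num.conj b = b -> a * a + b * b = 1 ->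
  block_mx (a *: 1%:M) (- b *: Q^t*) (b *: Q) (a *: 1%:M) \is unitarymx.
Proof.
move=> uQ ca cb ab; apply: unitarymxI.
have adjZ (x : K) m n (X : 'M[K]_(m, n)) : (x *: X)^t* = Num.conj x *: X^t*.
  by apply/matrixP => i j; rewrite !mxE rmorphM.
have cNb : Num.conj (- b) = - b by rewrite rmorphN /= cb.
rewrite block_adjmx !adjZ adjmx1 trmxCK cNb ca cb mulmx_block.
rewrite -!scalemxAl -!scalemxAr !scalerA !mul1mx !mulmx1 unitarymxl // unitarymxr //.
rewrite -!scalerDl mulrNN (addrC (b * b)) ab !scale1r (@scalar_mx_block _ k k).
by congr (block_mx _ _ _ _); rewrite ?mulrN ?mulNr (mulrC a) ?subrr ?addNr scale0r.
Qed.

End BlockAlgebra.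

Section NormalGeodesic.
Variables (R : realType) (k : nat).
Notation C := R[i].

(** E and G stand for the exponentials of t v and of - t A; only these properties
    of the exponentials matter. *)
Record geodesic_flow (A B : 'M[C]_k) (E : R -> 'M[C]_(k + k)) (G : R -> 'M[C]_k) : Prop :=
  GeodesicFlow {
    flowE_unitary : forall t, E t \is unitarymx;
    flowG_unitary : forall t, G t \is unitarymx;
    flowE0 : E 0 = 1%:M;
    flowG0 : G 0 = 1%:M;
    flowE_derive : forall t, is_mderive E t (E t *m block_mx A B (- B^t*) 0);
    flowG_derive : forall t, is_mderive G t (G t *m - A);
    flowG_comm : forall t, A *m G t = G t *m A }.

Definition flow_lift (E : R -> 'M[C]_(k + k)) (G : R -> 'M[C]_k) t : 'M[C]_(k + k) :=
  E t *m block_mx (G t) 0 0 1%:M.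

Lemma normal_geodesic_flow (A B : 'M[C]_k) : A^t* = - A ->
  exists E G, geodesic_flow A B E G /\
    normal_geodesic A B = fun t => stiefel_pi (flow_lift E G t).
Proof.
move=> skA; have skNA : (- A)^t* = - (- A) by rewrite adjmxN skA.
have skv := skew_block B skA.
exists (fun t => expmx (t%:C *: block_mx A B (- B^t*) 0)), (fun t => expmx (t%:C *: - A)).
split.
  split.
  - move=> t; exact: expmx_skew_unitary skv.
  - move=> t; exact: expmx_skew_unitary skNA.
  - exact: expmx_skew0 skv.
  - exact: expmx_skew0 skNA.
  - move=> t; exact: is_mderive_expmx skv.
  - move=> t; exact: is_mderive_expmx skNA.
  - move=> t; have := expmx_skew_comm t skNA; rewrite mulNmx mulmxN; exact: oppr_inj.
apply/funext => t; congr (stiefel_pi (_ *m _)).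
rewrite -(expmx_block _ _ skNA); congr expmx.
by rewrite scaleNr -scalerN opp_block_mx !oppr0.
Qed.

Variables (A B : 'M[C]_k) (E : R -> 'M[C]_(k + k)) (G : R -> 'M[C]_k).
Hypothesis flow : geodesic_flow A B E G.

Lemma flow_lift_unitary t : flow_lift E G t \is unitarymx.
Proof.
apply: mul_unitarymx; first exact: flowE_unitary flow t.
apply: block_unitary; exact: flowG_unitary flow t.
Qed.

Lemma flow_lift_velocity t :
  stiefel_pi (flow_lift E G t *m hmx ((G t)^t* *m B)) = - (rsubmx (E t) *m (B^t* *m G t)).
Proof. by rewrite stiefel_pi_hmx adjmxM trmxCK rsubmx_mul_block. Qed.

(** The control B is turned by the unitary matrix G t, so that the geodesic is
    horizontal with a control of constant norm. *)
Lemma is_mderive_flow_lift t : is_mderive (fun s => stiefel_pi (flow_lift E G s)) t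
  (stiefel_pi (flow_lift E G t *m hmx ((G t)^t* *m B))).
Proof.
rewrite flow_lift_velocity -(lsubmx_velocity _ _ (flowG_comm flow t)).
rewrite (_ : (fun s => _) = fun s => E s *m col_mx (G s) 0); last first.
  by apply/funext => s; exact: lsubmx_mul_block.
apply: is_mderiveM; first exact: flowE_derive flow t.
move=> i j; rewrite mxE; under eq_fun do rewrite mxE.
case: splitP => i' _; first exact: (flowG_derive flow t).
rewrite mxE; exact: is_cderive_cst.
Qed.

Lemma rdot_flow_control t : rdot ((G t)^t* *m B) ((G t)^t* *m B) = rdot B B.
Proof. by rewrite rdot_mulmxl // adjmxK; exact: unitarymxr (flowG_unitary flow t). Qed.

Lemma flow_lift0 : stiefel_pi (flow_lift E G 0) = col_mx 1%:M 0.
Proof.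
rewrite /stiefel_pi lsubmx_mul_block (flowE0 flow) (flowG0 flow); exact: mul1mx.
Qed.

Lemma flow_lift_velocity0 :
  stiefel_pi (flow_lift E G 0 *m hmx ((G 0)^t* *m B)) = col_mx 0 (- B^t*).
Proof.
rewrite flow_lift_velocity (flowE0 flow) (flowG0 flow) mulmx1.
by rewrite (@scalar_mx_block _ k k) block_mxEh row_mxKr mul_col_mx mul0mx mul1mx opp_col_mx oppr0.
Qed.

Lemma is_mderive2_flow_lift0 :
  is_mderive (fun t => stiefel_pi (flow_lift E G t *m hmx ((G t)^t* *m B))) 0
    (col_mx (- (B *m B^t*)) (B^t* *m A)).
Proof.
rewrite (_ : (fun s => _) = fun s => rsubmx (E s) *m (- B^t* *m G s)); last first.
  by apply/funext => t; rewrite flow_lift_velocity mulNmx mulmxN.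
have := is_mderiveM (is_mderive_rsubmx (flowE_derive flow 0))
  (is_mderiveMl (- B^t*) (flowG_derive flow 0)).
move=> /is_mderive_eq; apply.
by rewrite (flowE0 flow) (flowG0 flow) !mul1mx mulmx1 rsubmx_acceleration.
Qed.

End NormalGeodesic.

(** * The horizontal great circle arc *)

Section GreatArc.
Variables (R : realType) (k : nat).
Notation C := R[i].
Variables (Q : 'M[C]_k) (c : R).
Hypothesis uQ : Q \is unitarymx.

Definition great_arc (t : R) : 'M[C]_(k + k, k) :=
  (cos (c * t))%:C *: col_mx 1%:M 0 + (sin (c * t))%:C *: col_mx 0 Q.

Definition great_arc_velocity (t : R) : 'M[C]_(k + k, k) :=
  (- (c * sin (c * t)))%:C *: col_mx 1%:M 0 + (c * cos (c * t))%:C *: col_mx 0 Q.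

Definition great_arc_lift (t : R) : 'M[C]_(k + k) :=
  block_mx ((cos (c * t))%:C *: 1%:M) (- (sin (c * t))%:C *: Q^t*)
           ((sin (c * t))%:C *: Q) ((cos (c * t))%:C *: 1%:M).

Lemma conj_real_complex (x : R) : Num.conj (x%:C : C) = x%:C.
Proof. by apply/eqP; rewrite eq_complex /= oppr0 !eqxx. Qed.

Lemma adjmxZ_real m n (r : R) (X : 'M[C]_(m, n)) : (r%:C *: X)^t* = r%:C *: X^t*.
Proof. by apply/matrixP => i j; rewrite !mxE rmorphM /= conj_real_complex. Qed.

Lemma great_arc_liftE t : stiefel_pi (great_arc_lift t) = great_arc t.
Proof.
rewrite /stiefel_pi /great_arc_lift /great_arc block_mxEh row_mxKl !scale_col_mx add_col_mx.
by rewrite !scaler0 addr0 add0r.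
Qed.

Lemma great_arc_lift_unitary t : great_arc_lift t \is unitarymx.
Proof.
apply: great_arc_unitary; [exact: uQ | exact: conj_real_complex | exact: conj_real_complex |].
by rewrite -!rmorphM -rmorphD -!expr2 cos2Dsin2.
Qed.

Lemma is_derive_cosM (t : R) :
  is_derive t 1 (fun s : R => cos (c * s)) (- (c * sin (c * t))).
Proof.
have hd : is_derive t 1 (fun s : R => c * s) c.
  by apply: is_derive_eq (is_deriveZ c (is_derive_id t 1)) _; rewrite /GRing.scale /= mulr1.
by apply: is_derive_eq (is_derive1_comp (is_derive_cos _) hd) _; rewrite mulrC mulrN.
Qed.

Lemma is_derive_sinM (t : R) :
  is_derive t 1 (fun s : R => sin (c * s)) (c * cos (c * t)).
Proof.
have hd : is_derive t 1 (fun s : R => c * s) c.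
  by apply: is_derive_eq (is_deriveZ c (is_derive_id t 1)) _; rewrite /GRing.scale /= mulr1.
by apply: is_derive_eq (is_derive1_comp (is_derive_sin _) hd) _; rewrite mulrC.
Qed.

Lemma is_mderive_great_arc t : is_mderive great_arc t (great_arc_velocity t).
Proof.
by apply: is_mderiveD; apply: is_mderiveZ; [exact: is_derive_cosM|exact: is_derive_sinM].
Qed.

Lemma is_mderive2_great_arc t :
  is_mderive great_arc_velocity t ((- c ^+ 2)%:C *: great_arc t).
Proof.
rewrite (_ : _ *: _ = (- (c * (c * cos (c * t))))%:C *: col_mx 1%:M 0 +
   (c * (- (c * sin (c * t))))%:C *: col_mx 0 Q).
  apply: is_mderiveD; apply: is_mderiveZ.
    by apply: is_deriveN; exact: is_deriveZ (is_derive_sinM t).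
  exact: is_deriveZ (is_derive_cosM t).
rewrite /great_arc scalerDr !scalerA -!rmorphM.
by congr (_%:C *: _ + _%:C *: _); ring.
Qed.

Lemma great_arc_velocityE t :
  stiefel_pi (great_arc_lift t *m hmx (- (c%:C *: Q^t*))) = great_arc_velocity t.
Proof.
rewrite stiefel_pi_hmx adjmxN adjmxZ_real adjmxK mulmxN opprK.
rewrite /great_arc_lift block_mxEh row_mxKr.
rewrite mul_col_mx -!scalemxAl -!scalemxAr mul1mx (unitarymxl uQ) !scalerA.
rewrite /great_arc_velocity !scale_col_mx !scaler0 add_col_mx addr0 add0r.
congr (col_mx (_ *: _) (_ *: _)).
  by rewrite -rmorphN -rmorphM; congr (_%:C); ring.
by rewrite -rmorphM; congr (_%:C); ring.
Qed.

Lemma rdot_great_arc_control :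
  rdot (- (c%:C *: Q^t*)) (- (c%:C *: Q^t*)) = c ^+ 2 * k%:R.
Proof.
rewrite rdotNl rdotNr opprK rdotZl rdotZr rdot_adjmx mulrA -expr2; congr (_ * _).
by rewrite /rdot (unitarymxl uQ) mxtrace1 -(rmorph_nat (real_complex R)).
Qed.

End GreatArc.

(** * Uniqueness of minimizing normal geodesics *)

(** The great arc bounds the length of the geodesic, so the geodesic is a curve
    of the sphere of speed at most c sqrt k that joins two orthogonal points in
    time T = pi / (2 c), and must be that arc. The parameters are then found by
    comparing velocities and accelerations at time 0. *)
Lemma minimizing_normal_geodesic (R : realType) (k : nat)
    (Q A B : 'M[R[i]]_k) (T : R) : (0 < k)%N ->
  Q \is unitarymx -> A^t* = - A -> 0 < T ->
  minimizing 0 T (normal_geodesic A B) -> normal_geodesic A B T = col_mx 0 Q ->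
  A = 0 /\ B = - ((pi / (2 * T))%:C *: Q^t*).
Proof.
move=> k0 uQ skA T0 + gT; set c : R := pi / (2 * T).
have T2 : 0 < T / 2 by lra.
have T2T : T / 2 < T by lra.
have c0 : 0 < c by rewrite divr_gt0 ?pi_gt0 // mulr_gt0.
have cT : c * T = pi / 2 by rewrite /c; field; rewrite gt_eqF.
have [E [G [flow gE]]] := normal_geodesic_flow B skA.
rewrite gE in gT * => -[_]; set u := fun t => _ in gT * => mn.
have uL := flow_lift_unitary flow.
have ud := is_mderive_flow_lift flow.
have arc0 : great_arc Q c 0 = col_mx 1%:M 0.
  by rewrite /great_arc mulr0 cos0 sin0 scale0r addr0 scale1r.
have arcT : great_arc Q c T = col_mx 0 Q.
  by rewrite /great_arc cT cos_pihalf sin_pihalf scale0r add0r scale1r.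
have u0 : u 0 = col_mx 1%:M 0 := flow_lift0 flow.
have uT : u T = col_mx 0 Q := gT.
have al t : is_mderive (fun s => stiefel_pi (great_arc_lift Q c s)) t
    (stiefel_pi (great_arc_lift Q c t *m hmx (- (c%:C *: Q^t*)))).
  rewrite great_arc_velocityE; last exact: uQ.
  apply: is_mderive_ext (is_mderive_great_arc Q c t) => s.
  by rewrite great_arc_liftE.
have au := great_arc_lift_unitary c uQ.
have an (t : R) := rdot_great_arc_control c uQ.
have Bc : rdot B B <= c ^+ 2 * k%:R.
  have : (sr_length 0 T u <= sr_length 0 T (fun s => stiefel_pi (great_arc_lift Q c s)))%E.
    rewrite mn; apply: ereal_inf_lbound.
    exists 0, T, (fun s => stiefel_pi (great_arc_lift Q c s)); split.
    - exact: T0.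
    - exact: lift_horizontal_curve au al an _.
    - rewrite great_arc_liftE arc0; exact: esym u0.
    - rewrite great_arc_liftE arcT; exact: esym uT.
    - by [].
  rewrite (lift_length uL ud (rdot_flow_control flow) T0) (lift_length au al an T0) lee_fin.
  have K0 : 0 < 4 * (k + k)%:R :> R by rewrite mulr_gt0 // ltr0n addn_gt0 k0.
  rewrite ler_pM2r; last exact: T0.
  rewrite ler_sqrt; last by rewrite mulr_ge0 ?(ltW K0) // mulr_ge0 ?sqr_ge0.
  by rewrite ler_pM2l.
have orth : rdot (u T) (u 0) = 0.
  by rewrite u0 uT /rdot tr_col_mx map_row_mx mul_row_col adjmx0 mul0mx add0r mulmx0 mxtrace0.
have on_arc (t : R) : 0 <= t <= T -> u t = great_arc Q c t.
  move=> tT.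
  have N0 : 0 < k%:R :> R by rewrite ltr0n.
  have -> : u t = (cos (c * t))%:C *: u 0 + (sin (c * t))%:C *: u T; last by rewrite u0 uT.
  apply: (great_circle_of_orthogonal_ends N0 (ltW c0) cT ud _ _ _ _ tT).
  - by move=> s; exact: rdot_stiefel_pi (uL s).
  - by move=> s; exact: rdot_hmx_stiefel_pi (uL s).
  - by move=> s; rewrite (rdot_hmx _ (uL s)) (rdot_flow_control flow).
  - exact: orth.
(* Stopping at T / 2 leaves room to the right of t, and still lets the
   velocities be differentiated at 0. *)
have on_velocity (t : R) : 0 <= t <= T / 2 ->
    stiefel_pi (flow_lift E G t *m hmx ((G t)^t* *m B)) = great_arc_velocity Q c t.
  move=> /andP[t0 tT]; have tT' : t < T := le_lt_trans tT T2T.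
  apply: right_mderive_uniq tT' _ (ud t) (is_mderive_great_arc Q c t) => x /andP[tx xT].
  by apply: on_arc; rewrite xT (le_trans t0 tx).
have BE : B = - (c%:C *: Q^t*).
  have := on_velocity 0; rewrite lexx (ltW T2) => /(_ isT).
  rewrite (flow_lift_velocity0 flow) /great_arc_velocity mulr0 sin0 cos0 mulr0 mulr1.
  rewrite oppr0 scale0r add0r scale_col_mx scaler0 => /eq_col_mx [_] h.
  by rewrite -[LHS]adjmxK -[B^t*]opprK h adjmxN adjmxZ_real.
split; last exact: BE.
have := right_mderive_uniq T2 on_velocity (is_mderive2_flow_lift0 flow)
  (is_mderive2_great_arc Q c 0).
rewrite arc0 scale_col_mx scaler0 => /eq_col_mx [_].
rewrite BE adjmxN adjmxZ_real adjmxK mulNmx -scalemxAl => /eqP.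
rewrite oppr_eq0 scaler_eq0 => /orP[/eqP/(congr1 (@complex.Re R)) /= c00|/eqP QA].
  by move: c0; rewrite c00 ltxx.
by rewrite -[A]mul1mx -(unitarymxl uQ) -mulmxA QA mulmx0.
Qed.

Theorem proposition4 (R : realType) (k : nat) (hk : (1 <= k)%N)
    (C D : 'M[R[i]]_k) (hC : C \is unitarymx) (hD : D \is unitarymx) :
  ~ normal_cut_locus (stiefel_pi (block_mx 0 D C 0)).
Proof.
rewrite {1}/stiefel_pi block_mxEh row_mxKl.
move=> [T [_ [_ [T0 [[A1 [B1 [sk1 ->]]] [A2 [B2 [sk2 ->]]]] ne [m1 m2] [e1 e2]]]]].
have [A1E B1E] := minimizing_normal_geodesic hk hC sk1 T0 m1 e1.
have [A2E B2E] := minimizing_normal_geodesic hk hC sk2 T0 m2 e2.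
by case: ne; rewrite A1E B1E A2E B2E.
Qed.
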